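(* Let $\Gamma$ be a group with identity $e$, let $(\Gamma_i)_{i\ge 1}$ be a sequence of finite index subgroups of $\Gamma$ with $\Gamma_{i+1}\subsetneq\Gamma_i$ for every $i$, and let $\Gamma\curvearrowright X:=\varprojlim\Gamma/\Gamma_i$ be the associated odometer. Then the action $\Gamma\curvearrowright X$ is topologically free if and only if, for every $\gamma\in\left(\bigcap_i\Gamma_i\right)\setminus\{e\}$ and every $j\geq 1$, there exists $b\in\Gamma_j$ such that $b^{-1}\gamma b\notin\bigcap_i\Gamma_i$.
   Context: Odometer: given a group $\Gamma$ and a sequence $(\Gamma_i)_{i\geq 1}$ of finite index subgroups with $\Gamma_{i+1}\subsetneq\Gamma_i$ for all $i$, let $p_i\colon\Gamma/\Gamma_{i+1}\to\Gamma/\Gamma_i$, $p_i(\gamma\Gamma_{i+1})=\gamma\Gamma_i$, and let $X=\varprojlim(\Gamma/\Gamma_i,p_i)=\{(x_i)\in\prod_i\Gamma/\Gamma_i : p_i(x_{i+1})=x_i \text{ for all } i\}$ with the topology inherited from the product of the finite discrete spaces $\Gamma/\Gamma_i$ (it is homeomorphic to the Cantor set). The group $\Gamma$ acts on $X$ by $\gamma(x_i)=(\gamma x_i)$; this action is called an odometer. Topologically free: an action of $\Gamma$ on a locally compact Hausdorff space $Y$ is topologically free if for every $\gamma\in\Gamma\setminus\{e\}$ the set $\{y\in Y:\gamma y=y\}$ has empty interior. *)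

(* Defs.v *)
From HB Require Import structures.
From mathcomp Require Import all_boot.
From mathcomp Require Import mathcomp_extra boolp classical_sets functions cardinality topology.
Set Implicit Arguments. Unset Strict Implicit. Unset Printing Implicit Defensive.
Local Open Scope classical_set_scope.
Local Open Scope group_scope.

Record continuous_action (G : groupType) (Y : topologicalType) := ContinuousAction {
  act :> G -> Y -> Y;
  act1 : forall y, act 1 y = y;
  actM : forall g h y, act (g * h) y = act g (act h y);
  act_continuous : forall g, continuous (act g)
}.

(* The notion is meant for Y locally compact Hausdorff; for the odometer this is
   [inverse_limit_hausdorff] and [inverse_limit_compact]. *)
Definition topologically_free (G : groupType) (Y : topologicalType)
    (a : continuous_action G Y) : Prop :=
  forall g : G, g <> 1 -> interior [set y | a g y = y] = set0.

Section Cosets.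
Variable G : groupType.
Implicit Types (H K : set G) (g h : G) (A : set G).

Definition lcoset g A : set G := [set g * a | a in A].

Definition lcosets H : set (set G) := [set lcoset g H | g in [set: G]].

Definition coset_space H : Type := discrete_topology (set_type (lcosets H)).
HB.instance Definition _ H := DiscreteTopology.on (coset_space H).

Lemma lcoset_in g H : lcoset g H \in lcosets H.
Proof. by apply/mem_set; exists g. Qed.

Definition coset H g : coset_space H := exist _ (lcoset g H) (lcoset_in g H).

Lemma cosetP H (x : coset_space H) : exists g, x = coset H g.
Proof.
case: x => A HA; have [g _ gA] := set_mem HA.
by exists g; apply: val_inj => /=; rewrite gA.
Qed.

Lemma lcosetM g h A : lcoset (g * h) A = lcoset g (lcoset h A).
Proof.
rewrite eqEsubset; split => [_ [a Aa <-]|_ [_ [a Aa <-] <-]].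
  by exists (h * a); [exists a | rewrite mulgA].
by exists a => //; rewrite mulgA.
Qed.

Lemma coset_act_in g H (x : coset_space H) : lcoset g (\val x) \in lcosets H.
Proof. by have [h ->] := cosetP x; rewrite /= -lcosetM lcoset_in. Qed.

Definition coset_act H g (x : coset_space H) : coset_space H :=
  exist _ (lcoset g (\val x)) (coset_act_in g x).

Lemma coset_actE H g h : coset_act g (coset H h) = coset H (g * h).
Proof. by apply: val_inj; rewrite /= lcosetM. Qed.

(* The projection G/H -> G/K, defined through a choice of representative;
   see [coset_projE] for the independence of that choice when H is contained
   in K. *)
Definition coset_proj H K (x : coset_space H) : coset_space K :=
  coset K (xget 1 (\val x)).

Lemma coset_projE H K g :
  group_closed [in H] -> group_closed [in K] -> H `<=` K ->
  coset_proj K (coset H g) = coset K g.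
Proof.
move=> HG KG HK; rewrite /coset_proj /=.
have H1 : H 1 by case: HG => /set_mem.
case: xgetP => [r _ [h /HK Kh <-]|/(_ g)]; last first.
  by case; exists 1; rewrite ?mulg1.
have KM := group_closedM KG; have KV := group_closedV KG.
have hK : h \in K by apply/mem_set.
apply: val_inj => /=; rewrite lcosetM; congr (lcoset g _).
rewrite eqEsubset; split => [_ [k Kk <-]|k Kk].
  by apply/set_mem/KM => //; apply/mem_set.
exists (h^-1 * k); last by rewrite mulgA mulgV mul1g.
by apply/set_mem/KM; [apply: KV | apply/mem_set].
Qed.

End Cosets.

Section Odometer.
Variables (G : groupType) (Gam : nat -> set G).

(* A point of [inverse_limit] has type [set_type inverse_limit], which carries
   the topology induced by the product topology.  The sequence is indexed
   from 0. *)
Definition inverse_limit :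
    set (prod_topology (fun i => coset_space (Gam i))) :=
  [set x | forall i, coset_proj (Gam i) (x i.+1) = x i].

Hypothesis Gam_group : forall i, group_closed [in Gam i].
Hypothesis Gam_decr : forall i, Gam i.+1 `<` Gam i.

Lemma odometer_act_in g (x : inverse_limit) :
  (fun i => coset_act g (\val x i)) \in inverse_limit.
Proof.
apply/mem_set => i; have /(_ i) := set_mem (valP x).
have projE h := coset_projE h (Gam_group i.+1) (Gam_group i) (Gam_decr i).1.
have [h ->] := cosetP (\val x i.+1).
by rewrite coset_actE !projE => <-; rewrite coset_actE.
Qed.

Definition odometer_act g (x : inverse_limit) : inverse_limit :=
  exist _ (fun i => coset_act g (\val x i)) (odometer_act_in g x).

Lemma odometer_act1 x : odometer_act 1 x = x.
Proof.
apply: val_inj; apply: functional_extensionality_dep => i /=.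
by have [h ->] := cosetP (\val x i); rewrite coset_actE mul1g.
Qed.

Lemma odometer_actM g h x :
  odometer_act (g * h) x = odometer_act g (odometer_act h x).
Proof.
apply: val_inj; apply: functional_extensionality_dep => i /=.
by have [k ->] := cosetP (\val x i); rewrite !coset_actE mulgA.
Qed.

Lemma inverse_limit_val_continuous i :
  continuous (fun x : inverse_limit => \val x i).
Proof.
move=> x; apply: (@continuous_comp _ _ _
  (fun y : inverse_limit => \val y : prod_topology _) (@proj nat (fun i => coset_space (Gam i)) i)).
  exact: initial_continuous.
exact: proj_continuous.
Qed.

Lemma odometer_act_continuous g : continuous (odometer_act g).
Proof.
apply: continuous_comp_initial => x.
have ? := fmap_filter (set_val \o odometer_act g) (nbhs_filter x).
apply/cvg_sup => i U [_ [[V oV <-] Vx VU]].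
apply: (@filterS _ (nbhs x) _
  (fun y : inverse_limit => V (coset_act g (\val y i)))).
  by move=> y Vy; apply: (VU (fun i => coset_act g (\val y i))).
apply: (@inverse_limit_val_continuous i x (fun c => V (coset_act g c))).
by apply: open_nbhs_nbhs; split => //; exact: discrete_open.
Qed.

Definition odometer : continuous_action G inverse_limit :=
  ContinuousAction odometer_act1 odometer_actM odometer_act_continuous.

Lemma inverse_limit_hausdorff : hausdorff_space inverse_limit.
Proof.
move=> x y xy; apply: val_inj; apply: functional_extensionality_dep => i.
have nb (z : inverse_limit) : nbhs z [set t | \val t i = \val z i].
  apply: (@inverse_limit_val_continuous i z [set c | c = \val z i]).
  by apply: open_nbhs_nbhs; split => //; exact: discrete_open.
by have [z [/= <- <-]] := xy _ _ (nb x) (nb y).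
Qed.

Lemma inverse_limit_compact :
  (forall i, finite_set (lcosets (Gam i))) -> compact [set: inverse_limit].
Proof.
move=> fin.
have prodK : compact [set: prod_topology (fun i => coset_space (Gam i))].
  rewrite (_ : setT = [set f | forall i, [set: coset_space (Gam i)] (f i)]).
    refine (@tychonoff nat (fun i => coset_space (Gam i)) (fun=> setT) _) => i.
    apply: finite_compact.
    rewrite (_ : setT =
        (fun c : coset_space (Gam i) => \val c) @^-1` lcosets (Gam i)).
      by apply: finite_preimage (fin i) => c d _ _ /val_inj.
    by rewrite eqEsubset; split => // c _; exact: set_mem (valP c).
  by rewrite eqEsubset; split.
move=> F PF _; have [z [_ zF]] := prodK (set_val @ F) _ filterT.
have near_proj i : nbhs z [set y | y i = z i].
  apply: (@proj_continuous _ _ i z [set c | c = z i]).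
  by apply: open_nbhs_nbhs; split => //; exact: discrete_open.
have zL : z \in inverse_limit.
  apply/mem_set => i.
  have Fim : (set_val @ F) inverse_limit.
    by apply: (@filterS _ F _ setT); [move=> t _; exact: set_valP|exact: filterT].
  have [y [Ly [/= <- <-]]] := zF _ _ Fim (filterI (near_proj i) (near_proj i.+1)).
  exact: Ly.
exists (exist _ z zL); split => // A U FA [_ [[W oW <-] Wz WU]].
have FA' : (set_val @ F) (set_val @` A).
  by apply: (@filterS _ F _ A) => // t At; exists t.
have [_ [[t At <-] Wt]] := zF _ _ FA' (open_nbhs_nbhs (conj oW Wz)).
by exists t; split => //; exact: WU.
Qed.

End Odometer.

(* Main.v *)
Require Import Defs.
From mathcomp Require Import all_boot.
From mathcomp Require Import boolp classical_sets functions cardinality topology.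
Set Implicit Arguments. Unset Strict Implicit. Unset Printing Implicit Defensive.
Local Open Scope classical_set_scope.
Local Open Scope group_scope.

(** The orbit of the base point consists of the constant sequences [h Gam_i],
    and it is dense.  Such a sequence is fixed by [g] exactly when [h^-1 g h]
    lies in every [Gam_i] ([odometer_fix_point]), so fixed points translate into
    conjugates of [g] lying in the intersection [N] of the [Gam_i].  On the
    topological side, the cylinders [y_k = x_k] form a neighborhood base at [x]
    ([inverse_limit_nbhsE]), because the later coordinates of a point of the
    limit determine the earlier ones.

    If some nontrivial [g] in [N] has all its conjugates by [Gam_j] in [N], then
    [g] fixes the whole cylinder [x_j = Gam_j] pointwise: each coordinate of a
    point in it is a coset [b Gam_i] with [b] in [Gam_j].  Conversely, if [g]
    fixes a cylinder [x_k = h Gam_k] pointwise, it fixes the constant sequences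
    [h b Gam_i] for all [b] in [Gam_k]; hence [h^-1 g h] is in [N] together with
    all its conjugates by [Gam_k], which the condition forbids unless [g = 1]. *)

Lemma coset_eqP (G : groupType) (H : set G) (g h : G) :
  group_closed [in H] -> coset H g = coset H h <-> H (g^-1 * h).
Proof.
move=> HG; have HM := group_closedM HG; have HV := group_closedV HG.
have H1 : H 1 by case: HG => /set_mem.
split=> [/(congr1 val)/= gh|Hgh].
  have : lcoset h H h by exists 1; rewrite ?mulg1.
  by rewrite -gh => -[a Ha <-]; rewrite mulKg.
apply: val_inj => /=; rewrite -{1}(mulVKg g h) lcosetM; congr (lcoset g _).
rewrite eqEsubset; split=> [a Ha|_ [a Ha <-]].
  exists ((g^-1 * h)^-1 * a); last by rewrite mulVKg.
  by apply/set_mem/HM; [apply/HV/mem_set | apply/mem_set].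
by apply/set_mem/HM; apply/mem_set.
Qed.

Lemma coset_act_fixP (G : groupType) (H : set G) (g h : G) :
  group_closed [in H] ->
  coset_act g (coset H h) = coset H h <-> H (h^-1 * g * h).
Proof. by move=> HG; rewrite coset_actE -mulgA -coset_eqP. Qed.

Section InverseLimit.
Variables (G : groupType) (Gam : nat -> set G).
Hypothesis Gam_group : forall i, group_closed [in Gam i].
Hypothesis Gam_decr : forall i, Gam i.+1 `<` Gam i.
Local Notation X := (@inverse_limit G Gam).

Let projE i h :
  coset_proj (Gam i) (coset (Gam i.+1) h) = coset (Gam i) h :=
  coset_projE h (Gam_group i.+1) (Gam_group i) (Gam_decr i).1.

Lemma limit_point_in h : (fun i => coset (Gam i) h) \in X.
Proof. by apply/mem_set => i /=; rewrite projE. Qed.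

Definition limit_point h : X :=
  exist _ (fun i => coset (Gam i) h) (limit_point_in h).

(** Coordinate [k] determines all the earlier ones, by a common
    representative. *)
Lemma inverse_limit_coset_le (x : X) i k h :
  (i <= k)%N -> \val x k = coset (Gam k) h -> \val x i = coset (Gam i) h.
Proof.
elim: k => [|k IHk]; first by rewrite leqn0 => /eqP ->.
rewrite leq_eqVlt => /orP[/eqP -> //|/IHk{}IHk xk].
by apply: IHk; rewrite -(set_mem (valP x) k) xk projE.
Qed.

Definition cylinder (x : X) k : set X := [set y | \val y k = \val x k].

Lemma cylinder_le (x : X) i k : (i <= k)%N -> cylinder x k `<=` cylinder x i.
Proof.
move=> ik y yx; have [h xk] := cosetP (\val x k).
rewrite /cylinder /= (inverse_limit_coset_le ik xk).
by apply: (inverse_limit_coset_le ik); rewrite yx.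
Qed.

(** A neighborhood in the product constrains finitely many coordinates, and
    these constraints are implied by one on a large enough coordinate. *)
Lemma inverse_limit_nbhsE (x : X) (U : set X) :
  nbhs x U <-> exists k, cylinder x k `<=` U.
Proof.
split=> [[_ [[W oW <-] Wx WU]]|[k kU]]; last first.
  apply: filterS kU _.
  apply: (@inverse_limit_val_continuous G Gam k x [set c | c = \val x k]).
  by apply: open_nbhs_nbhs; split=> //; exact: discrete_open.
(* The filter generated by the cylinders converges to [x] in the product, as
   convergence there can be tested on each coordinate separately. *)
pose F := filter_from [set: nat] (cylinder x).
have FF : Filter F.
  apply: filter_from_filter; first by exists 0%N.
  move=> i j _ _; exists (maxn i j) => // y xy.
  by split; apply: cylinder_le xy; rewrite (leq_maxl, leq_maxr).
have Fx : (set_val @ F) --> (\val x : prod_topology _).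
  apply/cvg_sup => i V [_ [[Z oZ <-] Zx ZV]].
  by exists i => // y yx; apply: ZV; move: Zx; rewrite /= -[X in Z X]yx.
have [k _ kW] := Fx _ (open_nbhs_nbhs (conj oW Wx)).
by exists k => y /kW; exact: WU.
Qed.

Lemma odometer_fix_point g h :
  odometer Gam_group Gam_decr g (limit_point h) = limit_point h <->
  (\bigcap_i Gam i) (h^-1 * g * h).
Proof.
split=> [gh i _|gh].
  by apply/coset_act_fixP => //; exact: (congr1 (fun z : X => \val z i) gh).
apply: val_inj; apply: functional_extensionality_dep => i /=.
by apply/coset_act_fixP => //; exact: gh.
Qed.

End InverseLimit.

Theorem proposition2p1 (G : groupType) (Gam : nat -> set G)
    (Gam_group : forall i, group_closed [in Gam i])
    (Gam_finite_index : forall i, finite_set (lcosets (Gam i)))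
    (Gam_decr : forall i, Gam i.+1 `<` Gam i) :
  topologically_free (odometer Gam_group Gam_decr) <->
  (forall g : G, ((\bigcap_i Gam i) `\` [set 1]) g ->
   forall j : nat, exists2 b : G, Gam j b & ~ (\bigcap_i Gam i) (b^-1 * g * b)).
Proof.
split=> [free g [_ /= g1] j|conj_out g g1].
  apply: contrapT => no_b.
  have conj_in b : Gam j b -> (\bigcap_i Gam i) (b^-1 * g * b).
    by move=> jb; apply: contrapT => nb; apply: no_b; exists b.
  pose x := limit_point Gam_group Gam_decr 1.
  suff : interior [set y | odometer Gam_group Gam_decr g y = y] x by rewrite free.
  apply/(inverse_limit_nbhsE Gam_group Gam_decr); exists j => y yx.
  apply: val_inj; apply: functional_extensionality_dep => i /=.
  (* A representative at level [max i j] serves for both coordinates, so it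
     lies in [Gam j] since [y] is in the cylinder. *)
  have [b yb] := cosetP (\val y (maxn i j)).
  have yE := inverse_limit_coset_le Gam_group Gam_decr _ yb.
  rewrite (yE i (leq_maxl i j)); apply/coset_act_fixP => //.
  apply: conj_in => //; rewrite -[b]mul1g -invg1; apply/coset_eqP => //.
  by rewrite -(yE j (leq_maxr i j)) yx.
rewrite -subset0 => x /(inverse_limit_nbhsE Gam_group Gam_decr)[k fixed].
have [h xh] := cosetP (\val x k).
have conj_in b : Gam k b -> (\bigcap_i Gam i) (b^-1 * (h^-1 * g * h) * b).
  move=> kb.
  suff : (\bigcap_i Gam i) ((h * b)^-1 * g * (h * b)) by rewrite invgM !mulgA.
  apply/odometer_fix_point; apply: fixed; rewrite /cylinder /= xh.
  by apply/esym/coset_eqP => //; rewrite mulKg.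
have k1 : Gam k 1 by case: (Gam_group k) => /set_mem.
have gh_in : ((\bigcap_i Gam i) `\` [set 1]) (h^-1 * g * h).
  split=> [|/= gh1]; first by have := conj_in 1 k1; rewrite invg1 mul1g mulg1.
  apply: g1; move/(congr1 (fun a => h * a * h^-1)): gh1.
  by rewrite !mulgA mulgV mul1g mulgK mulg1 mulgV.
by have [b kb] := conj_out _ gh_in k; apply; exact: conj_in.
Qed.
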